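(* Working in the internal logic of an arbitrary topos, let $L$ be a Boolean algebra and $\mu$ a probability valuation on $L$. Then $\mu(x)$ is a Dedekind real for every $x\in L$.
   Context: Lower reals are (rounded, inhabited, downward closed) sets of rationals, equivalently reals approximated from below; $[0,1]_l$ denotes lower reals between $0$ and $1$. A probability valuation on a Boolean algebra $L$ is a function $\mu:L\to[0,1]_l$ with $\mu(0)=0$, $\mu(1)=1$, $x\le y\Rightarrow\mu(x)\le\mu(y)$, and $\mu(x)+\mu(y)=\mu(x\wedge y)+\mu(x\vee y)$. ''Dedekind real'' means the lower real is located, i.e. determines a Dedekind cut (for rationals $s<t$, $s<\mu(x)$ or $\mu(x)\le t$). No excluded middle or choice is assumed. *)

(* Defs.v *)
From Stdlib Require Import QArith.
Open Scope Q_scope.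

Record BooleanAlgebra := {
  ba_car :> Type;
  ba_bot : ba_car;
  ba_top : ba_car;
  ba_meet : ba_car -> ba_car -> ba_car;
  ba_join : ba_car -> ba_car -> ba_car;
  ba_compl : ba_car -> ba_car;
  ba_meetA : forall x y z, ba_meet x (ba_meet y z) = ba_meet (ba_meet x y) z;
  ba_joinA : forall x y z, ba_join x (ba_join y z) = ba_join (ba_join x y) z;
  ba_meetC : forall x y, ba_meet x y = ba_meet y x;
  ba_joinC : forall x y, ba_join x y = ba_join y x;
  ba_meetK : forall x y, ba_meet x (ba_join x y) = x;
  ba_joinK : forall x y, ba_join x (ba_meet x y) = x;
  ba_meetDr : forall x y z,
      ba_meet x (ba_join y z) = ba_join (ba_meet x y) (ba_meet x z);
  ba_meet1 : forall x, ba_meet x ba_top = x;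
  ba_join0 : forall x, ba_join x ba_bot = x;
  ba_meetCr : forall x, ba_meet x (ba_compl x) = ba_bot;
  ba_joinCr : forall x, ba_join x (ba_compl x) = ba_top
}.

Definition ba_le (L : BooleanAlgebra) (x y : L) : Prop := ba_meet L x y = x.

Record lreal := {
  lr_pred :> Q -> Prop;
  lr_inhabited : exists q, lr_pred q;
  lr_down : forall q r, q <= r -> lr_pred r -> lr_pred q;
  lr_rounded : forall q, lr_pred q -> exists r, q < r /\ lr_pred r
}.

Definition lr_le (x y : Q -> Prop) : Prop := forall q, x q -> y q.
Definition lr_eq (x y : Q -> Prop) : Prop := forall q, x q <-> y q.

Definition lr_const (c : Q) : Q -> Prop := fun q => q < c.

Definition lr_add (x y : Q -> Prop) : Q -> Prop :=
  fun q => exists a b, x a /\ y b /\ q < a + b.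

Definition lr_in01 (x : lreal) : Prop :=
  lr_le (lr_const 0) x /\ lr_le x (lr_const 1).

Definition prob_valuation (L : BooleanAlgebra) (mu : L -> lreal) : Prop :=
  (forall x, lr_in01 (mu x)) /\
  lr_eq (mu (ba_bot L)) (lr_const 0) /\
  lr_eq (mu (ba_top L)) (lr_const 1) /\
  (forall x y, ba_le L x y -> lr_le (mu x) (mu y)) /\
  (forall x y, lr_eq (lr_add (mu x) (mu y))
                     (lr_add (mu (ba_meet L x y)) (mu (ba_join L x y)))).

(** A lower real is a Dedekind real when it is located:
    for rationals s < t, s < x or x <= t. *)
Definition located (x : lreal) : Prop :=
  forall s t : Q, s < t -> x s \/ lr_le x (lr_const t).

(* Main.v *)
(** Since [x /\ ~x = 0] and [x \/ ~x = 1], modularity gives [mu x + mu ~x = 1].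
    Whenever two lower reals sum to a rational [c], each of them is located:
    approximating the sum from below to within [t - s] yields [a] in the first
    and [b] in the second with [a + b > c - (t - s)]; either [s <= a], or
    [b > c - t] and then no element of the first can reach [t]. *)

Require Import Defs.
From Stdlib Require Import QArith Lqa.

Lemma lr_add_const (u v : Q -> Prop) (a b : Q) :
  lr_eq u (lr_const a) -> lr_eq v (lr_const b) ->
  lr_eq (lr_add u v) (lr_const (a + b)).
Proof.
  unfold lr_eq, lr_add, lr_const. intros Hu Hv q. split.
  - intros (a' & b' & Ha' & Hb' & Hq).
    apply Hu in Ha'. apply Hv in Hb'. lra.
  - intros Hq.
    set (d := (a + b - q) * (1 # 3)).
    exists (a - d), (b - d).
    split; [apply Hu | split; [apply Hv |]]; unfold d; lra.
Qed.

Section SumToRational.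

Variables (x y : lreal) (c : Q).
Hypothesis sum_xy : lr_eq (lr_add x y) (lr_const c).

Lemma lr_add_const_ub (a b : Q) : x a -> y b -> a + b <= c.
Proof.
  intros Ha Hb. apply Qnot_lt_le. intros Hca.
  assert (Hc : lr_add x y c) by (exists a, b; auto).
  apply sum_xy in Hc. unfold lr_const in Hc. lra.
Qed.

Lemma lr_add_const_approx (e : Q) :
  0 < e -> exists a b, x a /\ y b /\ c - e < a + b.
Proof.
  intros He.
  assert (Hin : lr_add x y (c - e)) by (apply sum_xy; unfold lr_const; lra).
  destruct Hin as (a & b & Ha & Hb & Hab). exists a, b. auto.
Qed.

Lemma located_of_lr_add_const : located x.
Proof.
  intros s t Hst.
  destruct (lr_add_const_approx (t - s)) as (a & b & Ha & Hb & Hab); [lra |].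
  destruct (Qlt_le_dec a s) as [Has | Hsa].
  - right. intros q Hq. unfold lr_const.
    pose proof (lr_add_const_ub q b Hq Hb). lra.
  - left. exact (lr_down x s a Hsa Ha).
Qed.

End SumToRational.

Lemma prob_valuation_compl (L : BooleanAlgebra) (mu : L -> lreal) :
  prob_valuation L mu ->
  forall x : L, lr_eq (lr_add (mu x) (mu (ba_compl L x))) (lr_const 1).
Proof.
  intros (_ & Hbot & Htop & _ & Hmod) x q.
  rewrite (Hmod x (ba_compl L x) q), ba_meetCr, ba_joinCr.
  rewrite (lr_add_const _ _ 0 1 Hbot Htop q).
  unfold lr_const. split; intros; lra.
Qed.

Theorem lemma24 (L : BooleanAlgebra) (mu : L -> lreal) :
  prob_valuation L mu -> forall x : L, located (mu x).
Proof.
  intros Hmu x.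
  exact (located_of_lr_add_const (mu x) (mu (ba_compl L x)) 1
           (prob_valuation_compl L mu Hmu x)).
Qed.
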